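(* Let $w_0,w_1$ be the radial solution of the tt*-Toda equations on some interval $0<|t|<\epsilon$ obtained (via Iwasawa factorization, see context) from holomorphic data $p_i=c_iz^{k_i}$, $0\le i\le 3$. Assume $k_i>-1$ for all $i$ and $m_i-m_j\notin\mathbb Z$ for all $i\neq j$. Then, for $i=0,1$, $$2w_i(t)=\gamma_i\log|t|+\rho_i+o(1)\quad\text{as } t\to 0,$$ where $$\gamma_0=-2m_0=\tfrac1N(3\alpha_0-2\alpha_1-\alpha_2),\qquad \gamma_1=-2m_1=\tfrac1N(\alpha_0+2\alpha_1-3\alpha_2),$$ $$\rho_0=-2\log\hat c_0=-2\log\Big(c_0^{-\frac12}\,c^{\frac{1-2m_0}{8}}\big(\tfrac N4\big)^{m_0}\Big),\qquad \rho_1=-2\log\hat c_1=-2\log\Big(c_2^{\frac12}\,c^{\frac{-1-2m_1}{8}}\big(\tfrac N4\big)^{m_1}\Big).$$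
   Context: tt*-Toda equations: $2(w_i)_{t\bar t}=-e^{2(w_{i+1}-w_i)}+e^{2(w_i-w_{i-1})}$, indices mod $4$, $w_i$ real-valued, $w_i=w_i(|t|)$ (radial), $w_0+w_3=0=w_1+w_2$. A solution is thus given by $(w_0,w_1)$. Matrices are $4\times4$ with rows and columns indexed $0,1,2,3$. Holomorphic data: $c_i>0$, $k_i\in\mathbb R$ ($0\le i\le 3$) with $c_1=c_3$, $k_1=k_3$; $p_i(z)=c_iz^{k_i}$; $\alpha_i=k_i+1$; $c=c_0c_1c_2c_3$; $N=\alpha_0+\alpha_1+\alpha_2+\alpha_3$; $t=\frac4N c^{1/4}z^{N/4}$. Put $m_0=-m_3=\frac1{2N}(-3\alpha_0+2\alpha_1+\alpha_2)$, $m_1=-m_2=\frac1{2N}(-\alpha_0-2\alpha_1+3\alpha_2)$, $\hat c_0=\hat c_3^{-1}=c_0^{-1/2}c^{(1-2m_0)/8}(N/4)^{m_0}$, $\hat c_1=\hat c_2^{-1}=c_2^{1/2}c^{(-1-2m_1)/8}(N/4)^{m_1}$, and $h_i=\hat c_it^{m_i}$. Let $\eta$ be the matrix with entry $p_0$ in position $(0,3)$, $p_i$ in position $(i,i-1)$ for $i=1,2,3$, and $0$ elsewhere. Construction of the solution (when all $k_i>-1$): let $L(z,\lambda)$ be the solution of $L^{-1}L_z=\frac1\lambda\eta$ with $L|_{z=0}=I$. For $z$ near $0$ it has a unique Iwasawa factorization $L=L_{\mathbb R}L_+$, where $\Delta\,\overline{L_{\mathbb R}(z,\bar z,1/\bar\lambda)}\,\Delta=L_{\mathbb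 R}(z,\bar z,\lambda)$, $\Delta$ is the antidiagonal matrix with all antidiagonal entries $1$, and $L_+=\sum_{j\ge0}L_j(z,\bar z)\lambda^j$ with $L_0=\mathrm{diag}(b_0,b_1,b_2,b_3)$, $b_i>0$. Then $w_i=\log(b_i/|h_i|)$, regarded as a function of $t$, is a radial solution of the tt*-Toda equations on some interval $0<|t|<\epsilon$. *)

(* Defs.v *)
From HB Require Import structures.
From mathcomp Require Import all_boot all_order all_algebra.
From mathcomp Require Import complex.
From mathcomp Require Import all_classical all_reals all_analysis.

Set Implicit Arguments.
Unset Strict Implicit.
Unset Printing Implicit Defensive.

Import Order.TTheory GRing.Theory Num.Theory.
Import numFieldNormedType.Exports.

Local Open Scope classical_set_scope.
Local Open Scope complex_scope.
Local Open Scope ring_scope.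

(* R[i] carries no topology in the library; give it the one of a numFieldType
   as a normed module over itself. *)
HB.instance Definition _ (R : realType) := NormedModule.copy R[i] R[i]^o.

(* The index type 'I_4 carries the ring structure of integers mod 4, so that
   i + 1 and i - 1 are cyclic shifts and (3 : 'I_4) is the last index. *)

(* Points of the universal cover of C^* are represented by their logarithm
   s : R[i]; the underlying complex number is cexp s, and real powers of the
   (multivalued) coordinate become single-valued functions of s. *)
Section UniversalCover.
Context {R : realType}.
Implicit Types s : R[i].

Definition cexp s : R[i] :=
  (expR (complex.Re s) * cos (complex.Im s))
    +i* (expR (complex.Re s) * sin (complex.Im s)).

Definition upow s (a : R) : R[i] := cexp (a%:C * s).

Definition cabs (x : R[i]) : R := Normc.normc x.

(* The filter z -> 0, pulled back to the universal cover: |z| -> 0 with no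
   restriction on arg z. *)
Definition cover0 : set_system R[i] :=
  filter_from [set: R] (fun a => [set s | complex.Re s < a]).

#[global] Instance cover0_proper_filter : ProperFilter cover0.
Proof.
apply: filter_from_proper; first apply: filter_from_filter.
- by exists 0.
- move=> a b _ _; exists (Num.min a b) => // s /=.
  by rewrite lt_min => /andP[].
- by move=> a _; exists ((a - 1)%:C) => /=; rewrite ltrBlDr ltrDl.
Qed.

End UniversalCover.

Section HolomorphicData.
Context {R : realType}.
Variables c k : 'I_4 -> R.

Definition alpha (i : 'I_4) : R := k i + 1.
Definition cprod : R := \prod_i c i.
Definition Ntot : R := \sum_i alpha i.

Definition m0 : R :=
  (2 * Ntot)^-1 * (- 3 * alpha 0 + 2 * alpha 1 + alpha 2).
Definition m1 : R :=
  (2 * Ntot)^-1 * (- alpha 0 - 2 * alpha 1 + 3 * alpha 2).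
Definition mexp (i : 'I_4) : R := [:: m0; m1; - m1; - m0]`_i.

Definition chat0 : R :=
  c 0 `^ (- 2^-1) * cprod `^ ((1 - 2 * m0) / 8) * (Ntot / 4) `^ m0.
Definition chat1 : R :=
  c 2 `^ (2^-1) * cprod `^ ((- 1 - 2 * m1) / 8) * (Ntot / 4) `^ m1.
Definition chat (i : 'I_4) : R := [:: chat0; chat1; chat1^-1; chat0^-1]`_i.

(* s is the logarithm of z. *)
Definition pfun (i : 'I_4) (s : R[i]) : R[i] := (c i)%:C * upow s (k i).

Definition eta (s : R[i]) : 'M[R[i]]_4 :=
  \matrix_(i, j) if i == j + 1 then pfun i s else 0.

(* logt s is the logarithm of t = (4/N) c^(1/4) z^(N/4). *)
Definition logt (s : R[i]) : R[i] :=
  (ln (4 / Ntot * cprod `^ 4^-1))%:C + (Ntot / 4)%:C * s.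
Definition tabs (s : R[i]) : R := cabs (cexp (logt s)).

Definition hfun (i : 'I_4) (s : R[i]) : R[i] :=
  (chat i)%:C * upow (logt s) (mexp i).

(* L^-1 L_z = lambda^-1 eta and L = I at z = 0, with d/dz = e^-s d/ds; the
   derivative 'D_1 is the complex derivative with respect to s. *)
Definition canonical_L (L : R[i] -> R[i] -> 'M[R[i]]_4) : Prop :=
  forall lam : R[i], lam != 0 ->
    (L s lam @[s --> cover0] --> (1%:M : 'M[R[i]]_4)) /\
    (forall s : R[i],
      [/\ L s lam \in unitmx,
          derivable (fun s' : R[i] => L s' lam) s 1 &
          invmx (L s lam) *m (cexp (- s) *: 'D_1 (fun s' : R[i] => L s' lam) s)
            = lam^-1 *: eta s]).

End HolomorphicData.

Section Iwasawa.
Context {R : realType}.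

Definition Delta : 'M[R[i]]_4 := \matrix_(i, j) (i + j == 3)%:R.

(* Iwasawa factorization of a loop holomorphic on C^*, with b the diagonal of
   the constant term of L_+ .  The two factors extend from the unit circle to
   C^* by reflection, so all identities are imposed on the whole of C^*.  These
   conditions alone allow (L_R D, D^-1 L_+) with D = diag(d,d',d',d) positive;
   this freedom is removed by b_0 b_3 = 1 = b_1 b_2, which for
   w_i = log (b_i/|h_i|) is the condition w_0 + w_3 = 0 = w_1 + w_2. *)
Definition iwasawa (L : R[i] -> 'M[R[i]]_4) (b : 'I_4 -> R) : Prop :=
  exists (LR Lplus : R[i] -> 'M[R[i]]_4) (A : nat -> 'M[R[i]]_4),
    [/\ forall lam : R[i], lam != 0 -> L lam = LR lam *m Lplus lam,
        forall lam : R[i], lam != 0 ->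
          Delta *m map_mx conjc (LR (conjc lam)^-1) *m Delta = LR lam,
        forall lam : R[i],
          (\sum_(0 <= j < n) lam ^+ j *: A j) @[n --> \oo] --> Lplus lam,
        A 0%N = diag_mx (\row_i (b i)%:C) &
        forall i, 0 < b i].

End Iwasawa.

Section Toda.
Context {R : realType}.

(* f_{t tbar} = (f_xx + f_yy) / 4, where t = x + i y. *)
Definition dtdtbar (f : R -> R -> R) (x y : R) : R :=
  4^-1 * (derive1n 2 (fun x' => f x' y) x + derive1n 2 (fun y' => f x y') y).

Definition radial (f : R -> R) (x y : R) : R := f (Num.sqrt (x ^+ 2 + y ^+ 2)).

(* w_i = w_i(|t|); w i is only constrained on the interval (0, eps). *)
Definition ttToda_solution (eps : R) (w : 'I_4 -> R -> R) : Prop :=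
  [/\ forall (i : 'I_4) (r : R), 0 < r < eps ->
        derivable (w i) r 1 /\ derivable (derive1 (w i)) r 1,
      forall (i : 'I_4) (x y : R), 0 < Num.sqrt (x ^+ 2 + y ^+ 2) < eps ->
        2 * dtdtbar (radial (w i)) x y =
          - expR (2 * (radial (w (i + 1)) x y - radial (w i) x y))
          + expR (2 * (radial (w i) x y - radial (w (i - 1)) x y)) &
      forall r : R, 0 < r < eps -> w 0 r + w 3 r = 0 /\ w 1 r + w 2 r = 0].

End Toda.

(* w is the solution on 0 < |t| < eps constructed from the data (c, k). *)
Definition solution_from_data {R : realType} (c k : 'I_4 -> R) (eps : R)
    (w : 'I_4 -> R -> R) : Prop :=
  ttToda_solution eps w /\
  exists (L : R[i] -> R[i] -> 'M[R[i]]_4) (b : R[i] -> 'I_4 -> R),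
    canonical_L c k L /\
    forall s, tabs c k s < eps ->
      iwasawa (L s) (b s) /\
      forall i, w i (tabs c k s) = ln (b s i / cabs (hfun c k i s)).

(* Main.v *)
Require Import Defs.
From mathcomp Require Import all_boot all_order all_algebra.
From mathcomp Require Import complex.
From mathcomp Require Import all_classical all_reals all_analysis.
From mathcomp Require Import ring lra.

Import Order.TTheory GRing.Theory Num.Theory.
Import numFieldNormedType.Exports.

(** On the real axis log z = x, the loop L(x, lambda) tends to the identity
as x goes to -oo, and it does so uniformly for lambda on the unit circle.  The
Iwasawa factorization of a loop close to the identity has a diagonal close to
the identity.  Hence b_i -> 1, and
  2 w_i = 2 log b_i - 2 log |h_i| = 2 log b_i - 2 m_i log |t| - 2 log chat_i,
which is the claim, since every small |t| is reached by a real x.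

The uniform convergence of L is a Gronwall estimate
([frob_canonical_L_le]).  In the variable x the equation reads L' = L B, where B
is eta z / lambda, whose nonzero entries have modulus c_i exp(alpha_i x) on the
circle.  With nu = |L - 1|^2 (Frobenius norm) this gives
nu' <= 8 K (nu + 1), K = sum_i c_i exp(alpha_i x), and K is integrable at -oo
because alpha_i > 0.

The stability of the factorization ([iwasawa_diag_le]) is a maximum principle.
Write star M = Delta (conj M) Delta and, on the circle, U = L_R^-1; since
star L_R = L_R there, L_+ = U L and star L_+ = U (star L).  So the i-th rows p
of L_+ and q of star L_+ satisfy |p - q|^2 <= 16 nu |q|^2 as soon as
nu <= 1/16.  Now p extends holomorphically to the disc while q is the complex conjugate, up to a
permutation of the entries, of a vector that does; therefore
|p - q|^2 - 16 nu |q|^2 is subharmonic when 16 nu <= 1, and the inequality holds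
at the centre, where it says (b_i - b_{3-i})^2 <= 16 nu b_{3-i}^2
([disc_algebra_center]).  The normalization b_i b_{3-i} = 1 then gives
(b_i^2 - 1)^2 <= 16 nu. *)

Local Open Scope classical_set_scope.
Local Open Scope ring_scope.
Local Notation Re := complex.Re.
Local Notation Im := complex.Im.
Local Notation normc := Normc.normc.
Local Notation "x %:C" := (real_complex _ x) (format "x %:C").
Local Notation "R [i]" := (complex R) (format "R [i]").

(** * The modulus of complex numbers *)

Section Modulus.
Context {R : realType}.
Implicit Types x y z : R[i].

Lemma normcE2 x : normc x ^+ 2 = Re x ^+ 2 + Im x ^+ 2.
Proof. by case: x => a b; rewrite sqr_sqrtr // addr_ge0 ?sqr_ge0. Qed.

Lemma normc_ge0 x : 0 <= normc x.
Proof. by case: x => a b; exact: sqrtr_ge0. Qed.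

Lemma norm_normc x : `|x| = (normc x)%:C.
Proof. by case: x. Qed.

Lemma ReD x y : Re (x + y) = Re x + Re y. Proof. by case: x; case: y. Qed.
Lemma ImD x y : Im (x + y) = Im x + Im y. Proof. by case: x; case: y. Qed.
Lemma ReN x : Re (- x) = - Re x. Proof. by case: x. Qed.
Lemma ImN x : Im (- x) = - Im x. Proof. by case: x. Qed.
Lemma ReM x y : Re (x * y) = Re x * Re y - Im x * Im y.
Proof. by case: x; case: y. Qed.
Lemma ImM x y : Im (x * y) = Re x * Im y + Im x * Re y.
Proof. by case: x => a b; case: y => c d /=; ring. Qed.
Lemma ReCM (a : R) x : Re (a%:C * x) = a * Re x.
Proof. by rewrite ReM /= mul0r subr0. Qed.
Lemma ImCM (a : R) x : Im (a%:C * x) = a * Im x.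
Proof. by rewrite ImM /= mul0r addr0. Qed.
Lemma ReJ x : Re (conjc x) = Re x. Proof. by case: x. Qed.
Lemma ImJ x : Im (conjc x) = - Im x. Proof. by case: x. Qed.
Lemma Re_sum (I : finType) (F : I -> R[i]) : Re (\sum_i F i) = \sum_i Re (F i).
Proof. by elim/big_rec2: _ => // i a b _ <-; rewrite ReD. Qed.

Lemma Re_le_normc x : Re x <= normc x.
Proof.
rewrite (le_trans (ler_norm _))// -ler_sqr ?nnegrE ?normc_ge0//.
by rewrite real_normK ?num_real// normcE2 lerDl sqr_ge0.
Qed.

Lemma normcJ x : normc (conjc x) = normc x.
Proof. by case: x => a b /=; rewrite sqrrN. Qed.

Lemma normcC (a : R) : normc a%:C = `|a|.
Proof. by rewrite /= expr0n addr0 sqrtr_sqr. Qed.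

Lemma normc_sum (I : finType) (F : I -> R[i]) :
  normc (\sum_i F i) <= \sum_i normc (F i).
Proof.
elim/big_ind2: _ => [|x a y b xa yb|//]; first by rewrite Normc.normc0.
by rewrite (le_trans (le_normcD _ _)) ?lerD.
Qed.

Lemma normcX x n : normc (x ^+ n) = normc x ^+ n.
Proof.
by elim: n => [|n IH]; rewrite ?expr0 ?Normc.normc1// !exprS Normc.normcM IH.
Qed.

Lemma normc1_neq0 x : normc x = 1 -> x != 0.
Proof.
by move=> x1; apply: contra_eq_neq x1 => ->; rewrite Normc.normc0 eq_sym oner_neq0.
Qed.

(** Lagrange's identity: the difference of the two sides is half the sum of
the squares of the minors x_i y_j - x_j y_i. *)
Lemma cauchy_schwarz (I : finType) (x y : I -> R) :
  (\sum_i x i * y i) ^+ 2 <= (\sum_i x i ^+ 2) * (\sum_i y i ^+ 2).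
Proof.
suff : 0 <= \sum_i \sum_j (x i * y j - x j * y i) ^+ 2.
  suff -> : \sum_i \sum_j (x i * y j - x j * y i) ^+ 2 =
    2 * ((\sum_i x i ^+ 2) * (\sum_i y i ^+ 2)) - 2 * (\sum_i x i * y i) ^+ 2.
    lra.
  rewrite [in X in 2 * X - _]mulr_suml.
  transitivity (\sum_i \sum_j (x i ^+ 2 * y j ^+ 2)
     + \sum_i \sum_j (x j ^+ 2 * y i ^+ 2)
     - 2 * \sum_i \sum_j (x i * y i) * (x j * y j)).
    rewrite mulr_sumr -sumrN -!big_split; apply: eq_bigr => i _ /=.
    rewrite mulr_sumr -sumrN -!big_split; apply: eq_bigr => j _ /=; ring.
  rewrite [X in _ + X - _]exchange_big /= expr2 mulr_suml.
  have -> : \sum_i x i ^+ 2 * (\sum_j y j ^+ 2)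
     = \sum_i \sum_j x i ^+ 2 * y j ^+ 2.
    by apply: eq_bigr => i _; rewrite mulr_sumr.
  have -> : \sum_i (x i * y i * \sum_j x j * y j)
     = \sum_i \sum_j (x i * y i) * (x j * y j).
    by apply: eq_bigr => i _; rewrite mulr_sumr.
  ring.
by apply: sumr_ge0 => i _; apply: sumr_ge0 => j _; exact: sqr_ge0.
Qed.

Lemma normc_cauchy_schwarz (I : finType) (u f : I -> R[i]) :
  normc (\sum_i u i * f i) ^+ 2
    <= (\sum_i normc (u i) ^+ 2) * (\sum_i normc (f i) ^+ 2).
Proof.
apply: le_trans (cauchy_schwarz _ _ _).
rewrite ler_sqr ?nnegrE ?normc_ge0//; last first.
  by apply: sumr_ge0 => i _; rewrite mulr_ge0 ?normc_ge0.
rewrite (le_trans (normc_sum _ _))//.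
by apply: ler_sum => i _; rewrite Normc.normcM.
Qed.

Lemma normc_subr2 x y : normc (x - y) ^+ 2 <= 2 * normc x ^+ 2 + 2 * normc y ^+ 2.
Proof.
rewrite !normcE2 ReD ImD ReN ImN -subr_ge0.
rewrite (_ : _ - _ = (Re x + Re y) ^+ 2 + (Im x + Im y) ^+ 2); last by ring.
by rewrite addr_ge0 ?sqr_ge0.
Qed.

End Modulus.

(** * Holomorphic functions on the disc *)

Section DiscAlgebra.
Context {R : realType}.
Implicit Types (f g : R[i] -> R[i]) (v w : R[i]) (p q : {poly R[i]}).

(** The maximum principle for the harmonic function Re p.  Averaging p over
z and -z yields the even part of p as a polynomial in z^2, which has half the
size, takes the same value at 0 and satisfies the same bound on the circle;
repeating this ends at a constant. *)
Lemma poly_Re_le_center p (e : R) :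
  (forall z, normc z = 1 -> Re p.[z] <= e) -> Re p.[0] <= e.
Proof.
have [n] := ubnP (size p); elim: n p => // n IH p /ltnSE sp h.
have [sp1|sp1] := leqP (size p) 1.
  by move: (h 1 (@Normc.normc1 _)); rewrite (size1_polyC sp1) !hornerC.
have evenE z : p.[z] + p.[- z] = 2 * (even_poly p).[z ^+ 2].
  rewrite -{1 2}(poly_even_odd p) !hornerD !hornerM !horner_comp !hornerXn.
  rewrite !hornerX sqrrN; ring.
have <- : (even_poly p).[0] = p.[0].
  move: (evenE 0); rewrite oppr0 expr0n /= => H.
  have /mulfI : (2 : R[i]) != 0 by rewrite pnatr_eq0.
  by apply; rewrite -H; ring.
apply: IH => [|z z1].
  rewrite (leq_trans _ sp)// (leq_ltn_trans (size_even_poly _))//.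
  by rewrite ltn_uphalf_double -addnn -(add1n (size p)) ltn_add2r.
have [y yz] : exists y, y ^+ 2 = z by exists (sqrtc z); exact: sqr_sqrtc.
have y1 : normc y = 1.
  by apply/eqP; rewrite -sqrp_eq1 ?normc_ge0// -normcX yz z1.
have := h _ y1; have := h (- y); rewrite normcN => /(_ y1).
have := congr1 (@complex.Re R) (evenE y); rewrite yz ReD ReM /=; lra.
Qed.

Lemma poly_normc_bounded p :
  exists2 B : R, 0 < B & forall z, normc z = 1 -> normc p.[z] <= B.
Proof.
elim/poly_ind: p => [|p c [B B0 pB]].
  by exists 1 => // z _; rewrite horner0 Normc.normc0.
exists (B + normc c) => [|z z1]; first by rewrite ltr_wpDr ?normc_ge0.
rewrite hornerMXaddC (le_trans (le_normcD _ _))// lerD2r.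
by rewrite Normc.normcM z1 mulr1 pB.
Qed.

(** On the unit circle, [f] is the boundary value of a function holomorphic in
the disc that takes the value [v] at the centre: the disc algebra is the
uniform closure of the polynomials, and evaluation at 0 is continuous on it. *)
Definition disc_algebra f v := forall e : R, 0 < e ->
  exists2 p : {poly R[i]}, p.[0] = v &
    forall z, normc z = 1 -> normc (f z - p.[z]) <= e.

Lemma disc_algebra_Re_le_center f v (a : R) : disc_algebra f v ->
  (forall z, normc z = 1 -> Re (f z) <= a) -> Re v <= a.
Proof.
move=> fv fa; apply/ler_addgt0Pr => e e0; have [p <- pf] := fv e e0.
apply: poly_Re_le_center => z z1.
have := fa z z1; have := le_trans (Re_le_normc _) (pf z z1).
have := Re_le_normc (p.[z] - f z); rewrite -opprB normcN; have := pf z z1.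
rewrite ReN ReD ReN; lra.
Qed.

Lemma disc_algebraD f g v w : disc_algebra f v -> disc_algebra g w ->
  disc_algebra (fun z => f z + g z) (v + w).
Proof.
move=> fv gw e e0.
have [p <- pf] := fv (e / 2) (divr_gt0 e0 (ltr0Sn _ _)).
have [q <- qg] := gw (e / 2) (divr_gt0 e0 (ltr0Sn _ _)).
exists (p + q) => [|z z1]; rewrite hornerD//.
rewrite opprD addrACA (le_trans (le_normcD _ _))//.
have := pf z z1; have := qg z z1; lra.
Qed.

Lemma disc_algebra_cst v : disc_algebra (fun=> v) v.
Proof.
move=> e e0; exists v%:P => [|z _]; rewrite hornerC// subrr.
by rewrite Normc.normc0 ltW.
Qed.

Lemma disc_algebraM f g v w : disc_algebra f v -> disc_algebra g w ->
  disc_algebra (fun z => f z * g z) (v * w).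
Proof.
move=> fv gw e e0.
have [B B0 fB] : exists2 B : R, 0 < B & forall z, normc z = 1 -> normc (f z) <= B.
  have [p _ pf] := fv 1 ltr01; have [B B0 pB] := poly_normc_bounded p.
  exists (1 + B) => [|z z1]; first by rewrite addr_gt0.
  rewrite -(subrK p.[z] (f z)) (le_trans (le_normcD _ _))//.
  by rewrite lerD ?pf ?pB.
have [q <- qg] := gw (e / 2 / B) (divr_gt0 (divr_gt0 e0 (ltr0Sn _ _)) B0).
have [D D0 qD] := poly_normc_bounded q.
have [p <- pf] := fv (e / 2 / D) (divr_gt0 (divr_gt0 e0 (ltr0Sn _ _)) D0).
exists (p * q) => [|z z1]; rewrite hornerM//.
rewrite (_ : _ - _ = f z * (g z - q.[z]) + (f z - p.[z]) * q.[z]); last by ring.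
rewrite (le_trans (le_normcD _ _))// !Normc.normcM.
have -> : e = B * (e / 2 / B) + (e / 2 / D) * D.
  by field; rewrite !gt_eqF.
by rewrite lerD// ler_pM ?normc_ge0 ?fB ?qg ?pf ?qD.
Qed.

Lemma disc_algebra_sum (I : finType) (F : I -> R[i] -> R[i]) (V : I -> R[i]) :
  (forall i, disc_algebra (F i) (V i)) ->
  disc_algebra (fun z => \sum_i F i z) (\sum_i V i).
Proof.
move=> FV.
suff H r : disc_algebra (fun z => \sum_(i <- r) F i z) (\sum_(i <- r) V i).
  exact: H.
elim: r => [|i r IH].
  by rewrite big_nil; under eq_fun do rewrite big_nil; exact: disc_algebra_cst.
rewrite big_cons; under eq_fun do rewrite big_cons.
exact: disc_algebraD.
Qed.

(** The subharmonic function sum_i |p_i - conj g_i|^2 - D |g_i|^2 expands as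
sum_i |p_i|^2 + (1 - D) |g_i|^2 - 2 Re (p_i g_i).  Bounding |p|^2 from below by
its tangent 2 Re (conj a p) - |a|^2 at the value at the centre, and |g|^2
likewise, turns it into the real part of one holomorphic function without
changing its value at the centre. *)
Lemma disc_algebra_center (I : finType) (p g : I -> R[i] -> R[i])
    (a b : I -> R[i]) (D : R) :
  D <= 1 -> (forall i, disc_algebra (p i) (a i)) ->
  (forall i, disc_algebra (g i) (b i)) ->
  (forall z, normc z = 1 -> \sum_i normc (p i z - conjc (g i z)) ^+ 2
     <= D * \sum_i normc (g i z) ^+ 2) ->
  \sum_i normc (a i - conjc (b i)) ^+ 2 <= D * \sum_i normc (b i) ^+ 2.
Proof.
move=> D1 pa gb h.
(* Re (T x y x0 y0) is the lower bound by tangents at (x0, y0), up to the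
   constant |x0|^2 + (1 - D) |y0|^2. *)
pose T x y x0 y0 : R[i] := 2 * conjc x0 * x + 2 * (1 - D)%:C * conjc y0 * y
  + - 2 * (x * y).
have TE (x y x0 y0 : R[i]) : Re (T x y x0 y0) <=
   (normc (x - conjc y) ^+ 2 - D * normc y ^+ 2)
   + (normc x0 ^+ 2 + (1 - D) * normc y0 ^+ 2).
  rewrite !normcE2 /T !(ReD,ImD,ReM,ImM,ReN,ImN,ReJ,ImJ) /=.
  rewrite -subr_ge0.
  rewrite (_ : _ - _ = ((Re x - Re x0) ^+ 2 + (Im x - Im x0) ^+ 2)
    + (1 - D) * ((Re y - Re y0) ^+ 2 + (Im y - Im y0) ^+ 2)); last by ring.
  apply: addr_ge0; first by rewrite addr_ge0 ?sqr_ge0.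
  by apply: mulr_ge0; rewrite ?subr_ge0 ?addr_ge0 ?sqr_ge0.
have T0 (x y : R[i]) : Re (T x y x y) =
   (normc (x - conjc y) ^+ 2 - D * normc y ^+ 2)
   + (normc x ^+ 2 + (1 - D) * normc y ^+ 2).
  by rewrite !normcE2 /T !(ReD,ImD,ReM,ImM,ReN,ImN,ReJ,ImJ) /=; ring.
pose c := \sum_i (normc (a i) ^+ 2 + (1 - D) * normc (b i) ^+ 2).
have /disc_algebra_Re_le_center H : disc_algebra
    (fun z => \sum_i T (p i z) (g i z) (a i) (b i))
    (\sum_i T (a i) (b i) (a i) (b i)).
  apply: disc_algebra_sum => i; rewrite /T.
  do 2?[apply: disc_algebraD]; (apply: disc_algebraM; first exact: disc_algebra_cst) => //.
  exact: disc_algebraM.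
have : Re (\sum_i T (a i) (b i) (a i) (b i)) <= c.
  apply: H => z z1; rewrite Re_sum.
  apply: le_trans (ler_sum _ (fun i _ => TE _ _ _ _)) _.
  by rewrite big_split /= gerDr big_split /= sumrN -mulr_sumr subr_le0 h.
rewrite Re_sum; under eq_bigr do rewrite T0.
by rewrite big_split /= gerDr big_split /= sumrN -mulr_sumr subr_le0.
Qed.

End DiscAlgebra.

(** * Iwasawa factorization near the identity *)

Section Loops.
Context {R : realType}.
Implicit Types (M U : 'M[R[i]]_4) (z : R[i]).

Lemma cvg_mx_entry (T : Type) (F : set_system T) (f : T -> 'M[R[i]]_4) M i j
    (e : R) : Filter F -> f @ F --> M -> 0 < e ->
  \forall x \near F, normc (M i j - f x i j) < e.
Proof.
move=> FF fM e0.
have eC : 0 < e%:C by rewrite ltcR.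
have /= := fM _ (nbhsx_ballx M _ eC).
apply: (@filterS _ F) => x [_ /(_ i j)].
by rewrite /ball /= norm_normc ltcR.
Qed.

(** An everywhere convergent power series converges at z = 2, so its
coefficients decay like 2^-n and its partial sums converge uniformly on the
unit circle. *)
Lemma disc_algebra_series (a : nat -> R[i]) (f : R[i] -> R[i]) :
  (forall z (e : R), 0 < e -> \forall n \near \oo,
     normc (f z - \sum_(0 <= j < n) z ^+ j * a j) < e) ->
  disc_algebra f (a 0%N).
Proof.
pose S z n := \sum_(0 <= j < n) z ^+ j * a j.
move=> Sf.
have {}Sf z (e : R) : 0 < e -> exists N, forall n, (N <= n)%N -> normc (f z - S z n) < e.
  by move=> e0; have [N _ SN] := Sf z e e0; exists N => n /SN.
have [N aN] : exists N, forall n, (N <= n)%N -> normc (a n) <= 2 * 2^-1 ^+ n.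
  have [N SN] := Sf 2 1 ltr01; exists N => n Nn.
  have : normc (2 ^+ n * a n) <= 2.
    have -> : 2 ^+ n * a n = (f 2 - S 2 n) - (f 2 - S 2 n.+1).
      by rewrite /S big_nat_recr//=; ring.
    rewrite (le_trans (le_normcD _ _))// normcN.
    have := SN n Nn; have := SN n.+1 (leqW Nn); lra.
  rewrite Normc.normcM normcX (_ : normc 2 = 2); last first.
    by rewrite -(rmorph_nat (real_complex R) 2) normcC ger0_norm.
  by rewrite exprVn ler_pdivlMr ?exprn_gt0// mulrC.
(* Geometric tail: the sum of 2 * 2^-j over d <= j < d + m. *)
have tail z d m : normc z = 1 -> (N <= d)%N ->
    normc (S z (d + m)%N - S z d) <= 4 * 2^-1 ^+ d * (1 - 2^-1 ^+ m).
  move=> z1 Nd; elim: m => [|m IH].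
    by rewrite addn0 subrr Normc.normc0 expr0 subrr mulr0.
  rewrite addnS [S _ _.+1]big_nat_recr//= -/(S _ _) addrAC.
  rewrite (le_trans (le_normcD _ _))// Normc.normcM normcX z1 expr1n mul1r.
  have := aN (d + m)%N (leq_trans Nd (leq_addr _ _)).
  rewrite exprD exprS; lra.
move=> e e0.
have [d [d0 Nd de]] : exists d, [/\ (0 < d)%N, (N <= d)%N & 4 * 2^-1 ^+ d <= e / 2].
  have : (2^-1 ^+ n : R) @[n --> \oo] --> (0 : R).
    by apply: cvg_expr; rewrite ger0_norm ?invr_ge0// invf_lt1// ltr1n.
  move=> /cvgrPdist_lt/(_ (e / 8)); rewrite divr_gt0// => /(_ isT)[n _ Hn].
  exists (maxn n N).+1; split => //; first by rewrite leqW// leq_maxr.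
  have := Hn (maxn n N).+1; rewrite /= leqW ?leq_maxl// => /(_ isT).
  rewrite sub0r normrN ger0_norm ?exprn_ge0 ?invr_ge0//; lra.
exists (\poly_(j < d) a j) => [|z z1].
  by rewrite horner_coef0 coef_poly d0.
have -> : (\poly_(j < d) a j).[z] = S z d.
  rewrite horner_poly /S big_mkord; apply: eq_bigr => j _; exact: mulrC.
have [n0 Hn0] := Sf z (e / 2) (divr_gt0 e0 (ltr0Sn _ _)).
have := Hn0 (d + n0)%N (leq_addl _ _).
have := tail z d n0 z1 Nd.
have := le_normcD (f z - S z (d + n0)%N) (S z (d + n0)%N - S z d).
rewrite addrA subrK.
have : 0 <= 4 * 2^-1 ^+ d * 2^-1 ^+ n0 :> R by rewrite !mulr_ge0 ?exprn_ge0 ?invr_ge0.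
lra.
Qed.

(** Squared, so that its derivative along a curve of matrices is polynomial. *)
Definition frob M : R := \sum_k \sum_l normc (M k l) ^+ 2.

Lemma frob_ge0 M : 0 <= frob M.
Proof. by apply: sumr_ge0 => k _; apply: sumr_ge0 => l _; exact: sqr_ge0. Qed.

Lemma frobB M M' : frob (M - M') <= 2 * frob M + 2 * frob M'.
Proof.
rewrite /frob !mulr_sumr -big_split ler_sum// => k _ /=.
rewrite !mulr_sumr -big_split ler_sum// => l _ /=.
by rewrite !mxE normc_subr2.
Qed.

Lemma row_mulmx_le U M i :
  \sum_l normc ((U *m M) i l) ^+ 2 <= (\sum_k normc (U i k) ^+ 2) * frob M.
Proof.
rewrite /frob exchange_big mulr_sumr /=; apply: ler_sum => l _.
by rewrite mxE; exact: normc_cauchy_schwarz.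
Qed.

(** On the unit circle, where the inverse of the conjugate of lambda is lambda,
this is the reflection that fixes the factor L_R pointwise. *)
Definition star M : 'M[R[i]]_4 := Delta *m map_mx conjc M *m Delta.

Lemma starE M i j : star M i j = conjc (M (3 - i) (3 - j)).
Proof.
have D (k l : 'I_4) : (@Delta R) k l = (l == 3 - k)%:R.
  by rewrite mxE [l == _]eq_sym subr_eq [l + k]addrC eq_sym.
rewrite /star mxE (bigD1 (3 - j)) //= big1 ?addr0 => [|l lj].
  rewrite D opprB addrCA subrr addr0 eqxx mulr1 mxE (bigD1 (3 - i)) //=.
  rewrite big1 ?addr0 => [|l lj]; first by rewrite D eqxx mul1r mxE.
  by rewrite D (negbTE lj) mul0r.
rewrite D [j == _]eq_sym subr_eq [j + l]addrC -subr_eq eq_sym (negbTE lj).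
exact: mulr0.
Qed.

Lemma frob_starB1 M : frob (star M - 1%:M) = frob (M - 1%:M).
Proof.
have K : involutive (fun k : 'I_4 => 3 - k) by move=> k; rewrite opprB addrCA subrr addr0.
rewrite /frob (reindex_inj (inv_inj K)) /=; apply: eq_bigr => k _.
rewrite (reindex_inj (inv_inj K)) /=; apply: eq_bigr => l _.
rewrite mxE [LHS in normc LHS](_ : _ = conjc ((M - 1%:M) k l)) ?normcJ//.
rewrite starE !K !mxE rmorphB (inj_eq (inv_inj K)).
by rewrite /= conjc_nat.
Qed.

Lemma mulDeltaDelta : (@Delta R) *m Delta = 1%:M.
Proof.
apply/matrixP => i j; have := starE 1%:M i j.
by rewrite /star map_mx1 mulmx1 => ->; rewrite !mxE conjc_nat (inj_eq (subrI 3)).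
Qed.

Lemma starM M M' : star (M *m M') = star M *m star M'.
Proof.
rewrite /star map_mxM !mulmxA.
by rewrite -[X in _ = X *m _ *m _]mulmxA mulDeltaDelta mulmx1.
Qed.

(** On the circle let u be the i-th row of the inverse of L_R.  Then p = u L
and q = u (star L), and u, over which there is no a priori control, is
eliminated: |u| <= 2 |q| because star L is close to the identity. *)
Lemma iwasawa_diag_le (L : R[i] -> 'M[R[i]]_4) (b : 'I_4 -> R) (nu : R) :
  iwasawa L b -> (forall z, normc z = 1 -> L z \in unitmx) ->
  (forall z, normc z = 1 -> frob (L z - 1%:M) <= nu) -> nu <= 1 / 16 ->
  forall i, (b i - b (3 - i)) ^+ 2 <= 16 * nu * b (3 - i) ^+ 2.
Proof.
case=> LR [P [A [LE LRstar PE A0 b0]]] Lunit Lnu nu16 i.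
have entry k l : disc_algebra (fun z => P z k l) (A 0%N k l).
  apply: (@disc_algebra_series (fun j => A j k l)) => z e e0.
  have [N _ H] := cvg_mx_entry _ _ _ _ k l _ _ (PE z) e0.
  exists N => // n /H /=; rewrite summxE.
  rewrite (eq_bigr (fun j => z ^+ j * A j k l)) // => j _.
  by rewrite mxE.
have := @disc_algebra_center _ 'I_4 (fun l z => P z i l)
  (fun l z => P z (3 - i) (3 - l)) _ _ (16 * nu) _ (entry i)
  (fun l => entry (3 - i) (3 - l)).
have AE k l : A 0%N k l = (b k)%:C *+ (k == l) by rewrite A0 !mxE.
rewrite (bigD1 i)//= big1 ?addr0; last first.
  move=> l li; rewrite !AE [i == l]eq_sym (negbTE li) (inj_eq (subrI 3)) [i == l]eq_sym (negbTE li).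
  by rewrite !mulr0n conjc0 subrr Normc.normc0 expr0n.
rewrite (bigD1 i)//= big1 ?addr0; last first.
  move=> l li; rewrite AE (inj_eq (subrI 3)) [i == l]eq_sym (negbTE li).
  by rewrite mulr0n Normc.normc0 expr0n.
rewrite !AE !eqxx !mulr1n conjc_real -rmorphB !normcC !real_normK ?num_real//.
apply=> [|z z1]; first by lra.
have z0 := normc1_neq0 z z1.
have zJ : (conjc z)^-1 = z.
  have zz : z * conjc z = 1.
    apply/eqP; rewrite eq_complex ReM ImM ReJ ImJ /=.
    by have := normcE2 z; rewrite z1 => zE; apply/andP; split; apply/eqP; lra.
  by apply: (mulIf (x := conjc z)); rewrite ?conjc_eq0// mulVf ?conjc_eq0.
pose U := invmx (LR z).
have Uunit : LR z \in unitmx.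
  by have := Lunit z z1; rewrite LE// unitmx_mul => /andP[].
have starLR : star (LR z) = LR z by have := LRstar z z0; rewrite zJ.
have PU : P z = U *m L z by rewrite LE// mulKmx.
have starPU : star (P z) = U *m star (L z) by rewrite LE// starM starLR mulKmx.
pose Q := \sum_l normc (star (P z) i l) ^+ 2.
have -> : \sum_l normc (P z (3 - i) (3 - l)) ^+ 2 = Q.
  by apply: eq_bigr => l _; rewrite starE normcJ.
have -> : \sum_l normc (P z i l - conjc (P z (3 - i) (3 - l))) ^+ 2 =
    \sum_l normc ((U *m (L z - star (L z))) i l) ^+ 2.
  apply: eq_bigr => l _.
  by rewrite -starE starPU PU mulmxBr [in RHS]mxE [in X in _ = normc (_ + X) ^+ 2]mxE.
apply: le_trans (row_mulmx_le _ _ _) _.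
set u := \sum_k normc (U i k) ^+ 2.
have u0 : 0 <= u by apply: sumr_ge0 => k _; exact: sqr_ge0.
have fL : frob (L z - star (L z)) <= 4 * nu.
  rewrite (_ : _ - _ = (L z - 1%:M) - (star (L z) - 1%:M)); last first.
    by rewrite opprB addrA subrK.
  by apply: le_trans (frobB _ _) _; rewrite frob_starB1; have := Lnu z z1; lra.
have uQ : u <= 4 * Q.
  have : u <= 2 * Q + 2 * (u * frob (star (L z) - 1%:M)).
    apply: le_trans (_ : u <= 2 * Q + 2 * \sum_l normc
        ((U *m (star (L z) - 1%:M)) i l) ^+ 2) _; last first.
      by rewrite lerD2l ler_pM2l// row_mulmx_le.
    rewrite /u /Q !mulr_sumr -big_split ler_sum// => l _ /=.
    have -> : U i l = star (P z) i l - (U *m (star (L z) - 1%:M)) i l.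
      rewrite starPU mulmxBr mulmx1 [(_ - U) i l]mxE [(- U) i l]mxE.
      by rewrite opprB addrCA subrr addr0.
    exact: normc_subr2.
  rewrite frob_starB1; have := ler_wpM2l u0 (Lnu z z1).
  have := ler_wpM2l u0 nu16; lra.
have := ler_wpM2l u0 fL.
have nu0 : 0 <= nu by exact: le_trans (frob_ge0 _) (Lnu z z1).
have := ler_wpM2r nu0 uQ; lra.
Qed.

End Loops.

(** * Uniform convergence of the canonical solution *)

Section Gronwall.
Context {R : realType}.

(** Reduces the complex differential equation of L to real calculus on the axis
log z = x. *)
Lemma is_derive_real_line (f : R[i] -> 'M[R[i]]_4) (x : R) i j :
  derivable f x%:C 1 ->
  is_derive x (1 : R) (fun y => Re (f y%:C i j)) (Re ('D_1 f x%:C i j)) /\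
  is_derive x (1 : R) (fun y => Im (f y%:C i j)) (Im ('D_1 f x%:C i j)).
Proof.
move=> df.
pose D := 'D_1 f x%:C i j.
have near0 (e : R) : 0 < e -> \forall h \near (0 : R)^',
    normc (D - (h^-1)%:C * (f (h + x)%:C i j - f x%:C i j)) < e.
  move=> e0; have := cvg_mx_entry _ _ _ _ i j e _ df e0.
  case=> r /= r0 Hr.
  have r0' : 0 < Re r by move: r0; rewrite ltcE => /andP[].
  exists (Re r) => //= h; rewrite /ball_ /= sub0r normrN => hr h0.
  have rE : r = (Re r)%:C.
    by move: r0; rewrite ltcE => /andP[/eqP /= ri _]; case: (r) ri => ? ? /= ->.
  have hr' : `|0 - h%:C| < r by rewrite sub0r normrN norm_normc normcC rE ltcR.
  have h0' : h%:C != 0 by rewrite eq_complex negb_and /= h0.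
  have := Hr h%:C hr' h0'.
  rewrite !mxE.
  by rewrite -[_ *: 1]/(h%:C * 1) mulr1 -rmorphD -fmorphV.
have lineD (g : R[i] -> R) : (forall y z, g (y - z) = g y - g z) ->
    (forall (a : R) z, g (a%:C * z) = a * g z) -> (forall z, `|g z| <= normc z) ->
    is_derive x (1 : R) (fun y => g (f y%:C i j)) (g D).
  move=> gB gZ gle.
  have H : h^-1 *: (g (f (h *: 1 + x)%:C i j) - g (f x%:C i j))
      @[h --> (0 : R)^'] --> g D.
    apply/cvgrPdist_lt => e e0; have := near0 e e0; apply: filterS => h.
    rewrite -[h *: 1]/(h * 1) mulr1 -[_ *: _]/(_ * _) -gB -gZ -gB.
    exact: le_lt_trans.
  apply: DeriveDef; first by apply/cvg_ex; exists (g D).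
  exact/cvg_lim.
split; apply: lineD.
- by move=> y z; rewrite ReD ReN.
- by move=> a z; exact: ReCM.
- move=> z; rewrite -ler_sqr ?nnegrE ?normc_ge0// real_normK ?num_real//.
  by rewrite normcE2 lerDl sqr_ge0.
- by move=> y z; rewrite ImD ImN.
- by move=> a z; exact: ImCM.
- move=> z; rewrite -ler_sqr ?nnegrE ?normc_ge0// real_normK ?num_real//.
  by rewrite normcE2 lerDr sqr_ge0.
Qed.

Lemma is_derive_sumr n (h : 'I_n -> R -> R) (d : 'I_n -> R) (x : R) :
  (forall i, is_derive x (1 : R) (h i) (d i)) ->
  is_derive x (1 : R) (fun y => \sum_i h i y) (\sum_i d i).
Proof.
move=> hd; have := is_derive_sum hd.
by congr (is_derive _ _ _ _); apply/funext => y; rewrite fct_sumE.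
Qed.

Lemma is_derive_sqr_sub (u : R -> R) (a du x : R) :
  is_derive x (1 : R) u du ->
  is_derive x (1 : R) (fun y => (u y - a) ^+ 2) (2 * (u x - a) * du).
Proof.
move=> ux.
have H : is_derive x (1 : R) (fun y => u y - a) du.
  by apply: (is_derive_eq (is_deriveB ux (is_derive_cst a x 1))); rewrite subr0.
apply: (is_derive_eq (is_deriveX 2 H)).
by rewrite /= expr1 -[_ *: _]/(_ * _).
Qed.

Context (c k : 'I_4 -> R).
Context (c_gt0 : forall i, 0 < c i) (k_gtN1 : forall i, -1 < k i).

Lemma alpha_gt0 i : 0 < alpha k i.
Proof. by rewrite /alpha -ltrBlDr sub0r. Qed.

(** The modulus of z p_i(z) at log z = x. *)
Definition beta i (x : R) : R := c i * expR (alpha k i * x).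

(** The primitive of the sum of the [beta i] that vanishes at -oo. *)
Definition eta_primitive (x : R) : R := \sum_i c i / alpha k i * expR (alpha k i * x).

Lemma beta_ge0 i x : 0 <= beta i x.
Proof. by rewrite mulr_ge0 ?expR_ge0// ltW. Qed.

Lemma is_derive_expR_scale (a b x : R) :
  is_derive x (1 : R) (fun y => b * expR (a * y)) (b * (a * expR (a * x))).
Proof.
have H1 : is_derive x (1 : R) (fun y => a * y) a.
  by apply: (is_derive_eq (is_deriveZ a (is_derive_id x 1))); rewrite -[_ *: _]/(_ * _) mulr1.
apply: (is_derive_eq (is_deriveZ b (is_derive1_comp (is_derive_expR (a * x)) H1))).
by rewrite -[_ *: _]/(_ * _) [expR _ * a]mulrC.
Qed.

Lemma is_derive_eta_primitive x :
  is_derive x (1 : R) eta_primitive (\sum_i beta i x).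
Proof.
apply: is_derive_sumr => i.
apply: (is_derive_eq (is_derive_expR_scale (alpha k i) (c i / alpha k i) x)).
by rewrite mulrA divfK// gt_eqF ?alpha_gt0.
Qed.

Lemma eta_primitive_ge0 x : 0 <= eta_primitive x.
Proof.
apply: sumr_ge0 => i _; rewrite mulr_ge0 ?expR_ge0// divr_ge0 ?ltW//.
exact: alpha_gt0.
Qed.

Lemma cexp_real (a : R) : cexp a%:C = (expR a)%:C.
Proof. by rewrite /cexp /= cos0 sin0 mulr1 mulr0. Qed.

(** The equation L^-1 L_z = eta / lambda in the variable log z; eta has a single
nonzero entry in each column. *)
Lemma canonical_L_derive L lam x i j : canonical_L c k L -> lam != 0 ->
  'D_1 (fun s : R[i] => L s lam) x%:C i j =
    lam^-1 * (beta (j + 1) x)%:C * L x%:C lam i (j + 1).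
Proof.
move=> Lcan lam0; have [_ /(_ x%:C) [Lunit dL]] := Lcan lam lam0.
pose D := 'D_1 (fun s : R[i] => L s lam) x%:C; rewrite -/D.
move/(congr1 (fun M => cexp x%:C *: (L x%:C lam *m M))).
rewrite mulKVmx// scalerA -rmorphN !cexp_real -rmorphM -expRD subrr expR0 scale1r.
move=> ->; rewrite !mxE (bigD1 (j + 1))//= big1 ?addr0 => [|l lj].
  rewrite !mxE eqxx /pfun /upow -rmorphM cexp_real -rmorphM.
  rewrite /beta /alpha mulrDl mul1r expRD !rmorphM; ring.
by rewrite !mxE (negbTE lj) !mulr0.
Qed.

Lemma frob_sub1E (M : 'M[R[i]]_4) : frob (M - 1%:M) =
  \sum_i \sum_j ((Re (M i j) - (i == j)%:R) ^+ 2 + (Im (M i j) - 0) ^+ 2).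
Proof.
apply: eq_bigr => i _; apply: eq_bigr => j _.
rewrite !mxE normcE2 ReD ImD ReN ImN.
by case: (i == j); rewrite /= ?oppr0.
Qed.

Lemma frobN1 : frob (- 1%:M : 'M[R[i]]_4) = 4.
Proof.
rewrite /frob (eq_bigr (fun=> 1)) ?sumr_const ?card_ord// => i _.
rewrite (bigD1 i)//= big1 ?addr0 => [|j ji]; rewrite !mxE normcN.
  by rewrite eqxx Normc.normc1 expr1n.
by rewrite eq_sym (negbTE ji) Normc.normc0 expr0n.
Qed.

(** With F = L - 1 and nu = |F|^2, each entry contributes at most
K (|F_ij|^2 + |L_{i,j+1}|^2) to nu', and |L|^2 <= 2 nu + 8; hence the factor
8 K (nu + 1). *)
Lemma is_derive_frob_canonical_L L lam x : canonical_L c k L -> normc lam = 1 ->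
  exists2 d, is_derive x (1 : R) (fun y : R => frob (L y%:C lam - 1%:M)) d &
    d <= 8 * (\sum_i beta i x) * (frob (L x%:C lam - 1%:M) + 1).
Proof.
move=> Lcan lam1.
have lam0 := normc1_neq0 lam lam1.
pose f i j (y : R) := L y%:C lam i j.
pose D i j := 'D_1 (fun s : R[i] => L s lam) x%:C i j.
have dL : derivable (fun s : R[i] => L s lam) x%:C 1.
  by have [_ /(_ x%:C) []] := Lcan lam lam0.
pose K := \sum_i beta i x.
have bK i : beta i x <= K.
  by rewrite /K (bigD1 i)//= lerDl; apply: sumr_ge0 => j _; exact: beta_ge0.
pose d i j := 2 * (Re (f i j x) - (i == j)%:R) * Re (D i j)
            + 2 * (Im (f i j x) - 0) * Im (D i j).
have dE i j : d i j <= K * ((Re (f i j x) - (i == j)%:R) ^+ 2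
   + (Im (f i j x) - 0) ^+ 2 + normc (f i (j + 1) x) ^+ 2).
  pose w := lam^-1 * f i (j + 1) x.
  have -> : normc (f i (j + 1) x) ^+ 2 = normc w ^+ 2.
    by rewrite /w Normc.normcM Normc.normcV lam1 invr1 mul1r.
  have DE : D i j = (beta (j + 1) x)%:C * w.
    by rewrite /D canonical_L_derive// /w mulrCA mulrA.
  rewrite /d DE ReCM ImCM normcE2.
  set p := Re (f i j x) - _; set q := Im (f i j x) - _.
  apply: (@le_trans _ _ (beta (j + 1) x * (p ^+ 2 + q ^+ 2 + (Re w ^+ 2 + Im w ^+ 2)))).
    rewrite -subr_ge0.
    rewrite (_ : _ - _ = beta (j + 1) x * ((p - Re w) ^+ 2 + (q - Im w) ^+ 2)); last by ring.
    by rewrite mulr_ge0 ?beta_ge0 ?addr_ge0 ?sqr_ge0.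
  by rewrite ler_wpM2r ?bK// !addr_ge0 ?sqr_ge0.
exists (\sum_i \sum_j d i j).
  under eq_fun do rewrite frob_sub1E.
  apply: is_derive_sumr => i; apply: is_derive_sumr => j.
  have [uD vD] := is_derive_real_line _ x i j dL.
  exact: is_deriveD (is_derive_sqr_sub _ _ _ _ uD) (is_derive_sqr_sub _ _ _ _ vD).
set N := frob _.
have shiftE : \sum_i \sum_j normc (f i (j + 1) x) ^+ 2 = frob (L x%:C lam).
  by apply: eq_bigr => i _; rewrite [RHS](reindex_inj (addIr 1)).
have fL : frob (L x%:C lam) <= 2 * N + 8.
  have := frobB (L x%:C lam - 1%:M) (- 1%:M).
  by rewrite opprK subrK frobN1 -/N; lra.
have N0 : 0 <= N by exact: frob_ge0.
have K0 : 0 <= K by apply: sumr_ge0 => i _; exact: beta_ge0.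
apply: (@le_trans _ _ (K * (N + frob (L x%:C lam)))); last first.
  have -> : 8 * K * (N + 1) = K * (8 * (N + 1)) by ring.
  by rewrite ler_wpM2l//; lra.
rewrite -shiftE /N frob_sub1E -big_split mulr_sumr; apply: ler_sum => i _ /=.
by rewrite -big_split mulr_sumr; apply: ler_sum => j _ /=.
Qed.

Lemma frob_canonical_L_small L lam (e : R) : canonical_L c k L -> lam != 0 ->
  0 < e -> exists a : R, forall y, y < a -> frob (L y%:C lam - 1%:M) <= e.
Proof.
move=> Lcan lam0 e0; have [Llim _] := Lcan lam lam0.
(* There are 16 entries, and x^2 <= x for 0 <= x <= 1. *)
pose e' := Num.min 1 (e / 16).
have e'0 : 0 < e' by rewrite lt_min ltr01 divr_gt0.
have H (ij : 'I_4 * 'I_4) : \forall s \near cover0,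
    normc ((1%:M : 'M[R[i]]_4) ij.1 ij.2 - L s lam ij.1 ij.2) < e'.
  exact: cvg_mx_entry _ _ _ _ _ _ _ _ Llim e'0.
have [a _ Ha] := filter_forall _ H.
exists a => y ya; rewrite /frob.
apply: (@le_trans _ _ (\sum_(i < 4) \sum_(j < 4) e / 16)).
  apply: ler_sum => i _; apply: ler_sum => j _.
  have := Ha y%:C ya (i, j); rewrite /= !mxE -normcN opprB lt_min => /andP[le1 lee].
  apply: (le_trans _ (ltW lee)); rewrite expr2 ler_piMr ?normc_ge0//.
  exact: ltW.
by rewrite !sumr_const !card_ord -mulrnA -[leLHS]mulr_natr divfK ?pnatr_eq0.
Qed.

(** By the differential inequality (nu + 1) exp (-8 eta_primitive) is
nonincreasing, and it is at most 1 in the limit x -> -oo. *)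
Lemma frob_canonical_L_le L lam x : canonical_L c k L -> normc lam = 1 ->
  frob (L x%:C lam - 1%:M) + 1 <= expR (8 * eta_primitive x).
Proof.
move=> Lcan lam1.
have lam0 := normc1_neq0 lam lam1.
pose N (y : R) := frob (L y%:C lam - 1%:M).
pose E (y : R) := expR (- 8 * eta_primitive y).
pose phi (y : R) := (N y + 1) * E y.
have dphi y : exists2 d, is_derive y (1 : R) phi d & d <= 0.
  have [d Nd dle] := is_derive_frob_canonical_L L lam y Lcan lam1.
  have {}Nd : is_derive y (1 : R) N d by [].
  have N1 : is_derive y (1 : R) (fun y => N y + 1) d.
    by apply: (is_derive_eq (is_deriveD Nd (is_derive_cst (1 : R) y (1 : R)))); rewrite addr0.
  have E1 : is_derive y (1 : R) E (E y * (- 8 * \sum_i beta i y)).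
    apply: is_derive1_comp.
    exact: (@is_deriveZ _ _ _ _ (- 8) _ _ _ (is_derive_eta_primitive y)).
  exists ((N y + 1) * (E y * (- 8 * \sum_i beta i y)) + E y * d).
    exact: is_deriveM N1 E1.
  have -> : (N y + 1) * (E y * (- 8 * \sum_i beta i y)) + E y * d =
    E y * (d - 8 * (\sum_i beta i y) * (N y + 1)) by ring.
  by rewrite mulr_ge0_le0 ?expR_ge0// subr_le0.
have phi_nincr y : y <= x -> phi x <= phi y.
  move=> yx; apply: (@ler0_derive1_nincrNy _ _ x) => // [z _|z _|].
  - by have [d [dz _] _] := dphi z.
  - by have [d [_ dz] d0] := dphi z; rewrite derive1E dz.
  - apply: derivable_within_continuous => z _.
    by have [d [dz _] _] := dphi z.
have phi1 : phi x <= 1.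
  apply/ler_addgt0Pr => e e0.
  have [a Ha] := frob_canonical_L_small L lam e Lcan lam0 e0.
  pose y := Num.min x (a - 1).
  apply: le_trans (phi_nincr y _) _; first by rewrite ge_min lexx.
  have := Ha y; rewrite gt_min ltrBlDr ltrDl ltr01 orbT => /(_ isT) Ne.
  apply: (@le_trans _ _ (N y + 1)); last by rewrite addrC lerD2l.
  rewrite ler_piMr ?addr_ge0 ?frob_ge0//.
  by rewrite expR_le1 mulNr oppr_le0 mulr_ge0// eta_primitive_ge0.
have := phi1; rewrite /phi /E mulNr expRN.
by rewrite ler_pdivrMr ?expR_gt0// mul1r.
Qed.

End Gronwall.

(** * Asymptotics of the solution *)

Section Asymptotics.
Context {R : realType}.
Context (c k : 'I_4 -> R).
Context (c_gt0 : forall i, 0 < c i) (k_gtN1 : forall i, -1 < k i).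

Lemma Ntot_gt0 : 0 < Ntot k.
Proof.
rewrite /Ntot (bigD1 0)//= ltr_pwDl ?alpha_gt0//.
by apply: sumr_ge0 => i _; rewrite ltW ?alpha_gt0.
Qed.

Lemma chat_gt0 i : 0 < chat c k i.
Proof.
have cp0 : 0 < cprod c by apply: prodr_gt0.
have N40 : 0 < Ntot k / 4 by rewrite divr_gt0 ?Ntot_gt0.
have h0 : 0 < chat0 c k by rewrite !mulr_gt0 ?powR_gt0.
have h1 : 0 < chat1 c k by rewrite !mulr_gt0 ?powR_gt0.
by case: i => [[|[|[|[|//]]]] i4]; rewrite /chat /= ?invr_gt0.
Qed.

Lemma mexpE : ((mexp k 0 = m0 k) * (mexp k 1 = m1 k) * (mexp k 2 = - m1 k)
  * (mexp k 3 = - m0 k))%type.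
Proof. by []. Qed.

Lemma chatE : ((chat c k 0 = chat0 c k) * (chat c k 1 = chat1 c k)
  * (chat c k 2 = (chat1 c k)^-1) * (chat c k 3 = (chat0 c k)^-1))%type.
Proof. by []. Qed.

Lemma ord4_cases (i : 'I_4) : i = 0 \/ i = 1 \/ i = 2 \/ i = 3.
Proof.
case: i => [[|[|[|[|//]]]] i4].
- by left; apply/val_inj.
- by right; left; apply/val_inj.
- by do 2 right; left; apply/val_inj.
- by do 3 right; apply/val_inj.
Qed.

(** The real logarithm of z for which |t| = r. *)
Definition real_log_z (r : R) : R :=
  (ln r - ln (4 / Ntot k * cprod c `^ 4^-1)) / (Ntot k / 4).

Lemma logt_real_log_z r : logt c k (real_log_z r)%:C = (ln r)%:C.
Proof.
rewrite /logt -rmorphM -rmorphD; congr (_%:C).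
by rewrite /real_log_z [Ntot k / 4 * _]mulrC divfK ?subrKC// gt_eqF// divr_gt0 ?Ntot_gt0.
Qed.

Lemma tabs_real_log_z r : 0 < r -> tabs c k (real_log_z r)%:C = r.
Proof.
move=> r0; rewrite /tabs /cabs logt_real_log_z cexp_real lnK ?posrE//.
by rewrite normcC gtr0_norm.
Qed.

Lemma cabs_hfun_real_log_z i r : cabs (hfun c k i (real_log_z r)%:C) =
  chat c k i * expR (mexp k i * ln r).
Proof.
rewrite /cabs /hfun /upow logt_real_log_z -rmorphM cexp_real -rmorphM normcC.
by rewrite gtr0_norm// mulr_gt0 ?chat_gt0 ?expR_gt0.
Qed.

Lemma ln_quotient_hfun i r (b : R) : 0 < b ->
  ln (b / cabs (hfun c k i (real_log_z r)%:C)) =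
  ln b - ln (chat c k i) - mexp k i * ln r.
Proof.
move=> b0; rewrite cabs_hfun_real_log_z.
rewrite ln_div ?posrE ?mulr_gt0 ?chat_gt0 ?expR_gt0//.
by rewrite lnM ?posrE ?chat_gt0 ?expR_gt0// expRK opprD addrA.
Qed.

Lemma eta_primitive_real_log_z_cvg0 :
  eta_primitive c k (real_log_z r) @[r --> (0 : R)^'+] --> (0 : R).
Proof.
rewrite [X in _ --> X](_ : _ = \sum_(i < 4) (0 : R)); last by rewrite big1.
rewrite /eta_primitive.
apply: (@cvg_big R _ +%R 0 xpredT) => [|i _]; first exact: add_continuous.
pose a := alpha k i / (Ntot k / 4).
have a0 : 0 < a by rewrite divr_gt0 ?alpha_gt0 ?divr_gt0 ?Ntot_gt0.
pose C := c i / alpha k i * expR (- a * ln (4 / Ntot k * cprod c `^ 4^-1)).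
have H : C * r `^ a @[r --> (0 : R)^'+] --> C * 0.
  by apply: cvgM; [exact: cvg_cst|exact: (@powR_cvg0 R a a0)].
rewrite mulr0 in H; apply: (cvg_trans _ H); apply: near_eq_cvg.
near=> r; have r0 : 0 < r by near: r; exact: nbhs_right_gt.
have -> : r `^ a = expR (a * ln r) by rewrite /powR gt_eqF.
rewrite /C -mulrA -expRD; congr (_ * expR _).
rewrite /real_log_z /a; ring.
Unshelve. all: by end_near. Qed.

(** The function in question is 2 log b_i; its exponential b_i^2 tends to 1 by
the stability of the Iwasawa factorization. *)
Lemma solution_from_data_asymptotics (eps : R) (w : 'I_4 -> R -> R) i : 0 < eps ->
  solution_from_data c k eps w ->
  2 * (w i r + mexp k i * ln r + ln (chat c k i)) @[r --> (0 : R)^'+]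
    --> (0 : R).
Proof.
move=> eps0 [[_ _ wsum] [L [b [Lcan Lb]]]].
pose g r := 2 * (w i r + mexp k i * ln r + ln (chat c k i)).
pose nu r := expR (8 * eta_primitive c k (real_log_z r)) - 1.
have nu_cvg : nu r @[r --> (0 : R)^'+] --> (0 : R).
  have H : nu r @[r --> (0 : R)^'+] --> expR (8 * 0) - 1.
    apply: cvgB; last exact: cvg_cst.
    apply: (cvg_comp _ expR); last exact: continuous_expR.
    by apply: cvgM; [exact: cvg_cst|exact: eta_primitive_real_log_z_cvg0].
  by rewrite mulr0 expR0 subrr in H.
have main r : 0 < r < eps -> nu r <= 1 / 16 ->
    (expR (g r) - 1) ^+ 2 <= 16 * nu r.
  move=> /andP[r0 reps] nur.
  have := Lb (real_log_z r)%:C; rewrite tabs_real_log_z// => /(_ reps)[iw wE].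
  set B := b (real_log_z r)%:C in iw wE.
  have B0 j : 0 < B j by case: iw => ? [? [? []]].
  have gE j : ln (B j) = w j r + mexp k j * ln r + ln (chat c k j).
    by rewrite wE ln_quotient_hfun//; ring.
  (* The conditions w_0 + w_3 = 0 = w_1 + w_2 normalize b, because
     h_0 h_3 = 1 = h_1 h_2. *)
  have Bsum : ln (B i) + ln (B (3 - i)) = 0.
    have /wsum[w03 w12] : 0 < r < eps by rewrite r0.
    have rev j : ln (B j) + ln (B (3 - j)) = ln (B (3 - j)) + ln (B (3 - (3 - j))).
      by rewrite opprB addrCA subrr addr0 addrC.
    have B03 : ln (B 0) + ln (B 3) = 0.
      rewrite !gE (_ : _ + _ = w 0 r + w 3 r
        + (ln (chat0 c k) + ln (chat0 c k)^-1)); last first.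
        by rewrite !mexpE !chatE; ring.
      by rewrite w03 lnV ?posrE ?(chat_gt0 0)// subrr addr0.
    have B12 : ln (B 1) + ln (B 2) = 0.
      rewrite !gE (_ : _ + _ = w 1 r + w 2 r
        + (ln (chat1 c k) + ln (chat1 c k)^-1)); last first.
        by rewrite !mexpE !chatE; ring.
      by rewrite w12 lnV ?posrE ?(chat_gt0 1)// subrr addr0.
    have [->|[->|[->|->]]] := ord4_cases i.
    - by rewrite subr0.
    - by rewrite (_ : 3 - 1 = 2 :> 'I_4)//; apply/val_inj.
    - by rewrite (_ : 3 - 2 = 1 :> 'I_4) 1?addrC//; apply/val_inj.
    - by rewrite subrr addrC.
  have BE : B (3 - i) = (B i)^-1.
    have <- : expR (ln (B (3 - i))) = B (3 - i) by rewrite lnK ?posrE.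
    by rewrite -(addKr (ln (B i)) (ln (B (3 - i)))) Bsum addr0 expRN lnK ?posrE.
  have := @iwasawa_diag_le R _ _ (nu r) iw _ _ nur i.
  have gB : expR (g r) = B i ^+ 2.
    by rewrite /g -gE mulr_natl -lnXn// lnK// posrE exprn_gt0.
  rewrite BE => H.
  rewrite gB.
  have Bi0 : B i != 0 by rewrite gt_eqF.
  have -> : (B i ^+ 2 - 1) ^+ 2 = (B i - (B i)^-1) ^+ 2 * B i ^+ 2 by field.
  have -> : 16 * nu r = 16 * nu r * (B i)^-1 ^+ 2 * B i ^+ 2 by field.
  rewrite ler_pM2r ?exprn_gt0//; apply: H => z z1.
    have z0 := normc1_neq0 z z1.
    by have [_ /(_ (real_log_z r)%:C) []] := Lcan z z0.
  by rewrite /nu lerBrDr frob_canonical_L_le.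
have exp_cvg : expR (g r) @[r --> (0 : R)^'+] --> (1 : R).
  apply/cvgrPdist_lt => e e0.
  near=> r.
  have rr : 0 < r < eps by apply/andP; split; near: r; [exact: nbhs_right_gt|exact: nbhs_right_lt].
  have n1 : nu r <= 1 / 16.
    by near: r; apply: (cvgr_le _ nu_cvg); lra.
  have n2 : nu r < e ^+ 2 / 16.
    by near: r; apply: (cvgr_lt _ nu_cvg); rewrite divr_gt0 ?exprn_gt0.
  rewrite distrC -ltr_sqr ?nnegrE ?normr_ge0 ?(ltW e0)// real_normK ?num_real//.
  by have := main r rr n1; lra.
have : ln (expR (g r)) @[r --> (0 : R)^'+] --> ln (1 : R).
  by apply: (cvg_comp _ (@ln R) exp_cvg); exact: continuous_ln.
by rewrite ln1; under eq_fun do rewrite expRK.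
Unshelve. all: by end_near. Qed.

End Asymptotics.

Theorem proposition4p7 (R : realType) (c k : 'I_4 -> R)
  (eps : R) (w : 'I_4 -> R -> R)
  (c_gt0 : forall i, 0 < c i)
  (c13 : c 1 = c 3) (k13 : k 1 = k 3)
  (k_gtN1 : forall i, -1 < k i)
  (m_diff : forall i j : 'I_4, i != j -> mexp k i - mexp k j \isn't a Num.int)
  (eps_gt0 : 0 < eps)
  (w_sol : solution_from_data c k eps w) :
  let a := alpha k in
  let N := Ntot k in
  let gamma0 := - 2 * m0 k in
  let gamma1 := - 2 * m1 k in
  let rho0 := - 2 * ln (chat0 c k) in
  let rho1 := - 2 * ln (chat1 c k) in
  [/\ 2 * w 0 r - (gamma0 * ln r + rho0) @[r --> (0 : R)^'+] --> (0 : R),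
      2 * w 1 r - (gamma1 * ln r + rho1) @[r --> (0 : R)^'+] --> (0 : R),
      gamma0 = N^-1 * (3 * a 0 - 2 * a 1 - a 2) /\
      gamma1 = N^-1 * (a 0 + 2 * a 1 - 3 * a 2),
      rho0 = - 2 * ln (c 0 `^ (- 2^-1) * cprod c `^ ((1 - 2 * m0 k) / 8)
                       * (N / 4) `^ m0 k) &
      rho1 = - 2 * ln (c 2 `^ (2^-1) * cprod c `^ ((- 1 - 2 * m1 k) / 8)
                       * (N / 4) `^ m1 k)].
Proof.
move=> a N gamma0 gamma1 rho0 rho1.
have ln_cvg i := solution_from_data_asymptotics c k c_gt0 k_gtN1 eps w i eps_gt0 w_sol.
split => //.
- have := ln_cvg 0; apply: cvg_trans; apply: near_eq_cvg; near=> r.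
  by rewrite /gamma0 /rho0 mexpE chatE; ring.
- have := ln_cvg 1; apply: cvg_trans; apply: near_eq_cvg; near=> r.
  by rewrite /gamma1 /rho1 mexpE chatE; ring.
- have N0 : Ntot k != 0 by rewrite gt_eqF ?Ntot_gt0.
  by rewrite /gamma0 /gamma1 /m0 /m1 -/N -/a; split; field.
Unshelve. all: by end_near. Qed.
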